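(* Let $G$ be an arbitrary finite simple graph with $n$ vertices, $e$ edges and $t$ triangles, and let $P$ be a greedy partition of $G$. Then $t \ge r(P)\cdot\left(e - \frac{n^2}{4}\right)$.
   Context: A good partition $P$ of $V(G)$ is a partition of $V(G)$ into disjoint sets $C_1, C_2, \dots, C_r$ (the cliques of $P$), each inducing a complete subgraph of $G$, indexed so that $|C_1|\le |C_2|\le \dots\le |C_r|$. Its size is $r(P)=r$, the number of cliques. A good partition is a greedy partition if for every $i \ge 1$ the set $C_1\cup C_2\cup\dots\cup C_i$ induces a subgraph of $G$ containing no complete subgraph on $|C_i|+1$ vertices. (Equivalently, a greedy partition is obtained by repeatedly removing a maximum-size clique of the remaining graph, taken as the last remaining part.) *)

(* Defs.v *)
(* A finite simple graph = finType T with a symmetric,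
   irreflexive boolean relation e. *)
From HB Require Import structures.
From mathcomp Require Import all_boot all_order all_algebra.
Set Implicit Arguments. Unset Strict Implicit. Unset Printing Implicit Defensive.

Section Graphs.
Variable T : finType.
Variable e : rel T.

Definition is_clique (A : {set T}) : bool :=
  [forall x in A, forall y in A, (x != y) ==> e x y].

Definition n_edges : nat := #|[set A : {set T} | (#|A| == 2) && is_clique A]|.

Definition n_triangles : nat := #|[set A : {set T} | (#|A| == 3) && is_clique A]|.

Definition good_partition (P : seq {set T}) : Prop :=
  [/\ all (fun C : {set T} => C != set0) P,
      all is_clique P,
      (forall x : T, count (fun C : {set T} => x \in C) P = 1) &
      sorted (fun A B : {set T} => #|A| <= #|B|) P].

Definition greedy_partition (P : seq {set T}) : Prop :=
  good_partition P /\
  forall i, i < size P ->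
    forall K : {set T},
      K \subset \bigcup_(C <- take i.+1 P) C ->
      is_clique K -> #|K| != #|nth set0 P i|.+1.

End Graphs.

(* Main.v *)
Require Import Defs.
From HB Require Import structures.
From mathcomp Require Import all_boot all_order all_algebra.
From mathcomp Require Import polyrcf realalg ring lra.
Import Order.TTheory GRing.Theory Num.Theory.
Local Open Scope ring_scope.
Set Implicit Arguments. Unset Strict Implicit. Unset Printing Implicit Defensive.

(** Put weights [lam i >= 0] on the parts, give every vertex the weight of its
    part, and let [r], [n], [e], [t] be the weighted numbers of parts, vertices,
    edges and triangles, the last two for a graph [F] about which one only
    remembers that no vertex is joined to all of a part at least as large as its
    own. The bound is [r e - t <= r n^2/4], sharpened to [r^2 (n - r)] when
    [n <= 2 r]; both are proved by induction on the support of [lam], then on [F].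

    An edge of codegree larger than [r] can be deleted, since this increases
    [r e - t]; so all codegrees are at most [r]. Then for every vertex [v], with
    [psi u = r d(u) - t(u)],
      [r e - t <= r t(v) + sum of x_u psi(u) over the non-neighbours u of v].
    If the maximum of [psi] is at least [r^2], this inequality at a maximiser
    suffices. Otherwise, sum it over a part [C] of the largest size [k]: every
    vertex has a non-neighbour in [C], and one obtains
      [r * d(r e - t)/d(lam C) <= (3 - k) (r e - t) + (k - 1) r^2 n].
    So for [k >= 3] the difference between [r e - t] and its bound cannot
    increase with [lam C] while it is positive, and it is nonpositive at
    [lam C = 0] by induction. If all parts have size at most 2, the degrees
    alone give [e <= r (n - r)]. *)

(** * Descent for polynomials over a real closed field *)

(** If [p.[b]] were positive, [p] would be positive from its last root [z] before [b] up to [b],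
    hence nonincreasing there, which gives [p.[b] <= p.[z] <= 0]. *)
Lemma horner_le0_descent (R : rcfType) (p : {poly R}) (a b : R) :
  a <= b -> p.[a] <= 0 ->
  (forall s, a < s <= b -> 0 < p.[s] -> p^`().[s] <= 0) -> p.[b] <= 0.
Proof.
move=> ab pa dp; rewrite leNgt; apply/negP => pb.
have {}ab : a < b.
  rewrite lt_neqAle ab andbT; apply/eqP => E.
  by move: pb; rewrite -E ltNge pa.
have p0 : p != 0 by apply: contraTneq pb => ->; rewrite horner0 ltxx.
(* [prev_root] defaults to [a] when [p] has no root strictly between [a] and [b], so [p.[z] <= 0] in
   either case. *)
pose z := prev_root p a b.
have zab : a <= z < b.
  rewrite prev_root_lt // andbT.
  by have := prev_root_in p a b; rewrite in_itv /= minEle (ltW ab) => /andP[].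
have [az zb] := andP zab.
have pz : p.[z] <= 0.
  rewrite /z; case: prev_rootP => [p00|y _ -> //|y _ -> _].
    by rewrite p00 eqxx in p0.
  by rewrite minEle (ltW ab).
have nr : {in `]z, b[, forall x, ~~ root p x} by exact: prev_noroot.
have pos s : z < s < b -> 0 < p.[s].
  move=> /andP[zs sb]; rewrite ltNge; apply/negP => ps.
  have [ps0|ps0] := eqVneq p.[s] 0.
    by have := nr s; rewrite in_itv /= zs sb rootE ps0 eqxx => /(_ isT).
  have [|x xs rx] := @poly_ivtoo _ p s b (ltW sb).
    by rewrite nmulr_rlt0 // lt_neqAle ps0.
  have := nr x; rewrite rx in_itv /=; move: xs; rewrite in_itv /= => /andP[sx ->].
  by rewrite (lt_trans zs sx) => /(_ isT).
have dN x : x \in `]z, b[ -> 0 <= (- p)^`().[x].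
  rewrite in_itv /= derivN hornerN oppr_ge0 => xs; apply: dp (pos _ xs).
  by case/andP: xs => zx xb; rewrite (le_lt_trans az zx) ltW.
have := ler_hornerW dN; move=> /(_ z b); rewrite !in_itv /= !lexx (ltW zb) !hornerN.
by move=> /(_ isT isT isT); lra.
Qed.

(** * Weighted edge and triangle counts *)

Section WeightedCounts.
Variables (R : realFieldType) (V : finType) (F : rel V).
Implicit Types (x y z a b : V -> R) (r s k : R).

Definition adj u v : R := (F u v)%:R.

(** Polarised forms: counts can be split along [x = a + b], and for symmetric [F] the derivatives of
    [edge_form x x] and [tri_form x x x] in direction [y] are [2 * edge_form y x] and
    [3 * tri_form y x x]. *)
Definition edge_form x y := \sum_u \sum_v x u * y v * adj u v.

Definition tri_form x y z :=
  \sum_u \sum_v \sum_w x u * y v * z w * (adj u v * adj u w * adj v w).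

Definition deg x u := \sum_v x v * adj u v.

Definition tdeg x u := \sum_v \sum_w x v * x w * (adj u v * adj u w * adj v w).

Definition codeg x u v := \sum_w x w * (adj u w * adj v w).

(* The forms run over ordered tuples: [edge_form x x] and [tri_form x x x] are twice
   the number of edges and six times the number of triangles, so that [Phi] is
   [6 (r e - t)] and [Psi] is [2 psi]. *)
Definition Phi r x := 3 * r * edge_form x x - tri_form x x x.

Definition Psi r x u := 2 * r * deg x u - tdeg x u.

Lemma edge_form_deg x y : edge_form y x = \sum_u y u * deg x u.
Proof.
by apply: eq_bigr => u _; rewrite mulr_sumr; apply: eq_bigr => v _; rewrite mulrA.
Qed.

Lemma tri_form_tdeg x y : tri_form y x x = \sum_u y u * tdeg x u.
Proof.
apply: eq_bigr => u _; rewrite mulr_sumr; apply: eq_bigr => v _.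
by rewrite mulr_sumr; apply: eq_bigr => w _; ring.
Qed.

Lemma sum_Psi r x y :
  \sum_u y u * Psi r x u = 2 * r * edge_form y x - tri_form y x x.
Proof.
rewrite edge_form_deg tri_form_tdeg mulr_sumr -sumrB.
by apply: eq_bigr => u _; rewrite /Psi; ring.
Qed.

Lemma eq_edge_form x x' y y' :
  x =1 x' -> y =1 y' -> edge_form x y = edge_form x' y'.
Proof.
by move=> ex ey; apply: eq_bigr => u _; apply: eq_bigr => v _; rewrite ex ey.
Qed.

Lemma eq_tri_form x x' y y' z z' :
  x =1 x' -> y =1 y' -> z =1 z' -> tri_form x y z = tri_form x' y' z'.
Proof.
move=> ex ey ez; apply: eq_bigr => u _; apply: eq_bigr => v _.
by apply: eq_bigr => w _; rewrite ex ey ez.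
Qed.

Lemma adj_ge0 u v : 0 <= adj u v. Proof. exact: ler0n. Qed.

Lemma tri_form_ge0 x y z : (forall u, 0 <= x u) -> (forall u, 0 <= y u) ->
  (forall u, 0 <= z u) -> 0 <= tri_form x y z.
Proof.
move=> x0 y0 z0; do 3!apply: sumr_ge0 => ? _.
by rewrite !mulr_ge0 ?adj_ge0.
Qed.

Lemma tdeg_ge0 x u : (forall u, 0 <= x u) -> 0 <= tdeg x u.
Proof.
by move=> x0; do 2!apply: sumr_ge0 => ? _; rewrite !mulr_ge0 ?adj_ge0.
Qed.

Hypothesis F_sym : symmetric F.

Lemma adjC u v : adj u v = adj v u. Proof. by rewrite /adj F_sym. Qed.

Lemma edge_formC x y : edge_form x y = edge_form y x.
Proof.
rewrite /edge_form exchange_big; apply: eq_bigr => u _; apply: eq_bigr => v _.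
by rewrite adjC; ring.
Qed.

Lemma tri_formC x y z : tri_form x y z = tri_form y x z.
Proof.
rewrite /tri_form exchange_big; apply: eq_bigr => u _; apply: eq_bigr => v _.
by apply: eq_bigr => w _; rewrite (adjC v u); ring.
Qed.

Lemma tri_formAC x y z : tri_form x y z = tri_form x z y.
Proof.
apply: eq_bigr => u _; rewrite exchange_big; apply: eq_bigr => v _.
by apply: eq_bigr => w _; rewrite (adjC w v); ring.
Qed.

Lemma edge_formDl x y z s :
  edge_form (fun u => x u + s * y u) z = edge_form x z + s * edge_form y z.
Proof.
rewrite mulr_sumr -big_split; apply: eq_bigr => u _ /=.
rewrite mulr_sumr -big_split; apply: eq_bigr => v _ /=; ring.
Qed.

Lemma tri_formDl x x' y z s :
  tri_form (fun u => x u + s * x' u) y z = tri_form x y z + s * tri_form x' y z.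
Proof.
rewrite mulr_sumr -big_split; apply: eq_bigr => u _ /=.
rewrite mulr_sumr -big_split; apply: eq_bigr => v _ /=.
rewrite mulr_sumr -big_split; apply: eq_bigr => w _ /=; ring.
Qed.

Lemma tri_formDm x y y' z s :
  tri_form x (fun u => y u + s * y' u) z = tri_form x y z + s * tri_form x y' z.
Proof. by rewrite tri_formC tri_formDl (tri_formC y) (tri_formC y'). Qed.

Lemma tri_formDr x y z z' s :
  tri_form x y (fun u => z u + s * z' u) = tri_form x y z + s * tri_form x y z'.
Proof. by rewrite tri_formAC tri_formDm (tri_formAC x z) (tri_formAC x z'). Qed.

Lemma edge_form_line1 x y s (xs := fun u => x u + s * y u) :
  edge_form y xs = edge_form y x + s * edge_form y y.
Proof. by rewrite edge_formC edge_formDl (edge_formC x). Qed.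

Lemma edge_form_line x y s (xs := fun u => x u + s * y u) :
  edge_form xs xs = edge_form x x + 2 * s * edge_form y x + s ^+ 2 * edge_form y y.
Proof.
rewrite /xs edge_formDl (edge_formC x xs) edge_formDl edge_form_line1.
by rewrite (edge_formC y x); ring.
Qed.

Lemma tri_form_line1 x y s (xs := fun u => x u + s * y u) :
  tri_form y xs xs =
  tri_form y x x + 2 * s * tri_form y y x + s ^+ 2 * tri_form y y y.
Proof. by rewrite tri_formDm !tri_formDr (tri_formAC y x y); ring. Qed.

Lemma tri_form_line x y s (xs := fun u => x u + s * y u) :
  tri_form xs xs xs = tri_form x x x + 3 * s * tri_form y x x +
    3 * s ^+ 2 * tri_form y y x + s ^+ 3 * tri_form y y y.
Proof.
rewrite tri_formDl tri_form_line1 tri_formDm !tri_formDr.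
rewrite (tri_formAC x x y) (tri_formC x y x) (tri_formC x y y) (tri_formAC y x y).
by ring.
Qed.

(* Termwise [codeg <= r] turns the edges inside [b] into triangles with two
   vertices in [b]; what remains of the triangle count is [aaa + bbb]. *)
Lemma Phi_split_le r x a b : (forall u, 0 <= a u) -> (forall u, 0 <= b u) ->
    (forall u, x u = a u + b u) -> (forall u v, F u v -> codeg x u v <= r) ->
  Phi r x <= 3 * r * edge_form a a + 3 * \sum_u b u * Psi r x u.
Proof.
move=> a0 b0 xab light.
have e1 : x =1 (fun u => a u + 1 * b u) by move=> u; rewrite xab mul1r.
have le_bb : tri_form b b x <= r * edge_form b b.
  rewrite mulr_sumr; apply: ler_sum => u _; rewrite mulr_sumr.
  apply: ler_sum => v _.
  have -> : \sum_w b u * b v * x w * (adj u v * adj u w * adj v w) =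
      b u * b v * adj u v * codeg x u v.
    by rewrite mulr_sumr; apply: eq_bigr => w _; ring.
  rewrite [leRHS]mulrC; rewrite /adj; case Fuv: (F u v); last by rewrite mulr0 !mul0r.
  by rewrite ler_wpM2l ?light ?mulr1 ?mulr_ge0.
move: le_bb (tri_form_ge0 a0 a0 a0) (tri_form_ge0 b0 b0 b0); rewrite sum_Psi /Phi.
rewrite !(eq_edge_form e1 e1, eq_edge_form (frefl b) e1, eq_tri_form e1 e1 e1,
  eq_tri_form (frefl b) (frefl b) e1, eq_tri_form (frefl b) e1 e1).
rewrite edge_form_line edge_form_line1 tri_form_line tri_form_line1 tri_formDr.
by lra.
Qed.

Lemma sum_nonadj x v : \sum_u x u * (1 - adj v u) = \sum_u x u - deg x v.
Proof. by rewrite -sumrB; apply: eq_bigr => u _; ring. Qed.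

(** Take for [a] and [b] the weights on the neighbours and the non-neighbours of [v]: edges among
    the neighbours are triangles at [v], so [edge_form a a] is [tdeg x v]. *)
Lemma Phi_nbhd_le r x v : (forall u, 0 <= x u) ->
    (forall u v, F u v -> codeg x u v <= r) ->
  Phi r x <= 3 * r * tdeg x v + 3 * \sum_u x u * (1 - adj v u) * Psi r x u.
Proof.
move=> x0 light.
have -> : tdeg x v = edge_form (fun u => x u * adj v u) (fun u => x u * adj v u).
  by apply: eq_bigr => u _; apply: eq_bigr => w _; ring.
apply: Phi_split_le => // [u|u|u]; first by rewrite mulr_ge0 ?adj_ge0.
  by rewrite mulr_ge0 // subr_ge0 /adj; case: (F v u).
by ring.
Qed.

(** Here [rho] is the weight of the non-neighbours of [v]. Bounding their [Psi] by its maximum gives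
    [Phi <= 3 r tdeg(v) + 3 rho Psi(v)], and [Psi(v) = 2 r (n - rho) - tdeg(v)] eliminates one of
    the two quantities. *)
Lemma Phi_large_Psi r x v (n := \sum_u x u) (rho := n - deg x v) :
    0 <= r -> (forall u, 0 <= x u) -> (forall u v, F u v -> codeg x u v <= r) ->
    (forall u, Psi r x u <= Psi r x v) -> 2 * r ^+ 2 <= Psi r x v ->
  Phi r x <= 6 * r ^+ 2 * (n - r) \/
  r <= rho /\ Phi r x <= 6 * r * (rho * (n - rho)).
Proof.
move=> r0 x0 light maxv rv.
have rho0 : 0 <= rho.
  rewrite /rho -sum_nonadj sumr_ge0 // => u _.
  by rewrite mulr_ge0 // subr_ge0 /adj; case: (F v u).
have le1 : Phi r x <= 3 * r * tdeg x v + 3 * (rho * Psi r x v).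
  apply: le_trans (Phi_nbhd_le v x0 light) _; rewrite lerD2l ler_pM2l ?ltr0n //.
  rewrite /rho -sum_nonadj mulr_suml; apply: ler_sum => u _; apply: ler_wpM2l => //.
  by rewrite mulr_ge0 // subr_ge0 /adj; case: (F v u).
have t0 := tdeg_ge0 v x0.
have defPsi : Psi r x v = 2 * r * (n - rho) - tdeg x v by rewrite /Psi /rho; ring.
(* The bound equals [6 r rho (n - rho) - 3 (rho - r) tdeg(v)], good for [rho >= r], and also
   [6 r^2 (n - rho) - 3 (r - rho) Psi(v)], good for [rho < r] because [Psi(v) >= 2 r^2]. *)
have [le_rho|lt_rho] := lerP r rho; [right; split=> // | left].
  have : 0 <= (rho - r) * tdeg x v by rewrite mulr_ge0 // subr_ge0.
  by move: le1; rewrite defPsi; lra.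
have : 0 <= (r - rho) * (Psi r x v - 2 * r ^+ 2).
  by rewrite mulr_ge0 // subr_ge0 // ltW.
move: le1; have -> : tdeg x v = 2 * r * (n - rho) - Psi r x v by rewrite defPsi; ring.
lra.
Qed.

(** Average [Phi_nbhd_le] over [v] with weights [y v]. The term [x u * Psi r x u] then has
    coefficient [k - deg y u], which is 1 plus a nonnegative excess when [x u > 0]; only in the
    excess is [Psi] replaced by [2 r^2]. *)
Lemma Phi_clique_le r x y k (n := \sum_u x u) :
    0 <= r -> (forall u, 0 <= x u) -> (forall u v, F u v -> codeg x u v <= r) ->
    (forall u, Psi r x u <= 2 * r ^+ 2) -> (forall u, 0 <= y u) ->
    \sum_u y u = k -> (forall u, 0 < x u -> deg y u <= k - 1) ->
  k * Phi r x <= 3 * r * tri_form y x x + 3 * (2 * r * edge_form x x - tri_form x x x)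
    + 6 * r ^+ 2 * ((k - 1) * n - edge_form y x).
Proof.
move=> r0 x0 light smallPsi y0 sumy degy.
have le1 : k * Phi r x <= 3 * r * tri_form y x x +
    3 * \sum_u x u * Psi r x u * (k - deg y u).
  have -> : 3 * r * tri_form y x x + 3 * \sum_u x u * Psi r x u * (k - deg y u) =
    \sum_v y v * (3 * r * tdeg x v + 3 * \sum_u x u * (1 - adj v u) * Psi r x u).
    under [RHS]eq_bigr do rewrite mulrDr; rewrite big_split /=; congr (_ + _).
      by rewrite tri_form_tdeg mulr_sumr; apply: eq_bigr => v _; ring.
    under [RHS]eq_bigr do rewrite mulrCA mulr_sumr.
    rewrite -mulr_sumr exchange_big /=; congr (_ * _); apply: eq_bigr => u _.
    rewrite -sumy -sumrB mulr_sumr; apply: eq_bigr => v _.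
    by rewrite (adjC u v); ring.
  rewrite -sumy mulr_suml; apply: ler_sum => v _.
  by rewrite ler_wpM2l // Phi_nbhd_le.
apply: le_trans le1 _; rewrite -addrA lerD2l.
have le2 : \sum_u x u * Psi r x u * (k - deg y u) <=
    \sum_u (x u * Psi r x u + 2 * r ^+ 2 * ((k - 1) * x u - x u * deg y u)).
  apply: ler_sum => u _.
  have [xu0|xu0] := eqVneq (x u) 0; first by rewrite xu0; lra.
  have xu : 0 < x u by rewrite lt0r xu0 x0.
  have : 0 <= x u * ((2 * r ^+ 2 - Psi r x u) * (k - 1 - deg y u)).
    by rewrite mulr_ge0 // mulr_ge0 // subr_ge0 ?smallPsi ?degy.
  by lra.
move: le2; rewrite big_split /= -mulr_sumr sumrB -mulr_sumr -edge_form_deg.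
by rewrite sum_Psi (edge_formC x y) -/n; lra.
Qed.

End WeightedCounts.

(** * Deleting edges of large codegree *)

(** Every triangle of [F] loses at most one edge, so the triangles lost are counted exactly by the
    codegrees of the deleted edges, each at least [r]. *)
Lemma Phi_delete_le (R : realFieldType) (V : finType) (F F' : rel V) (x : V -> R) r :
    symmetric F -> symmetric F' -> subrel F' F -> (forall u, 0 <= x u) ->
    (forall u v w, F u v -> F u w -> F v w -> ~~ F' u v -> F' u w) ->
    (forall u v, F u v -> ~~ F' u v -> r <= codeg F x u v) ->
  Phi F r x <= Phi F' r x.
Proof.
move=> symF symF' subF x0 apart heavy.
pose d u v : R := adj R F u v - adj R F' u v.
have dC u v : d u v = d v u by rewrite /d (adjC _ symF) (adjC _ symF').
have EE : edge_form F x x - edge_form F' x x = \sum_u \sum_v x u * x v * d u v.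
  rewrite -sumrB; apply: eq_bigr => u _; rewrite -sumrB; apply: eq_bigr => v _.
  by rewrite /d; ring.
pose S := \sum_u \sum_v \sum_w x u * x v * x w * (d u v * adj R F u w * adj R F v w).
have TT : tri_form F x x x - tri_form F' x x x = 3 * S.
  (* With the deleted edge put in each of the three positions of the triple, the identity can be
     checked term by term. *)
  have -> : 3 * S = S +
      \sum_u \sum_v \sum_w x u * x v * x w * (d u w * adj R F u v * adj R F v w) +
      \sum_u \sum_v \sum_w x u * x v * x w * (d v w * adj R F u v * adj R F u w).
    have -> : 3 * S = S + S + S by ring.
    congr (_ + _ + _).
      apply: eq_bigr => u _; rewrite exchange_big; apply: eq_bigr => v _.
      by apply: eq_bigr => w _; rewrite (adjC _ symF w v); ring.
    rewrite /S; under eq_bigr do rewrite exchange_big /=.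
    rewrite exchange_big /=; apply: eq_bigr => u _; apply: eq_bigr => v _.
    by apply: eq_bigr => w _; rewrite (adjC _ symF v u) (adjC _ symF w u); ring.
  rewrite /S -sumrB -!big_split; apply: eq_bigr => u _ /=.
  rewrite -sumrB -!big_split; apply: eq_bigr => v _ /=.
  rewrite -sumrB -!big_split; apply: eq_bigr => w _ /=.
  rewrite -mulrBr -!mulrDr; congr (_ * _); rewrite /d /adj.
  have sF a b : F a b = false -> F' a b = false.
    by move=> Fab; apply: contraFF Fab; apply: subF.
  case Fuv: (F u v); last by rewrite (sF u v Fuv) /=; ring.
  case Fuw: (F u w); last by rewrite (sF u w Fuw) /=; ring.
  case Fvw: (F v w); last by rewrite (sF v w Fvw) /=; ring.
  have h1 := apart u v w Fuv Fuw Fvw.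
  have h2 : ~~ F' u v -> F' v w by rewrite symF'; apply: apart; rewrite // symF.
  have h3 : ~~ F' u w -> F' v w by rewrite symF' (symF' v); apply: apart; rewrite // symF.
  case: (F' u v) h1 h2 => [_ _|/(_ isT) -> /(_ isT) ->]; last by rewrite /=; ring.
  by case: (F' u w) h3 => [_|/(_ isT) ->]; case: (F' v w) => //=; ring.
rewrite /Phi.
have : r * \sum_u \sum_v x u * x v * d u v <= S.
  rewrite mulr_sumr; apply: ler_sum => u _; rewrite mulr_sumr; apply: ler_sum => v _.
  have -> : \sum_w x u * x v * x w * (d u v * adj R F u w * adj R F v w) =
      x u * x v * d u v * codeg F x u v.
    by rewrite mulr_sumr; apply: eq_bigr => w _; ring.
  rewrite mulrC; have := heavy u v; have := subF u v; rewrite /d /adj.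
  case: (F u v); case: (F' u v) => //=; rewrite ?subrr ?mulr0 ?mul0r //.
    by move=> _ /(_ isT isT) h; rewrite subr0 mulr1 ler_wpM2l ?mulr_ge0.
  by move/(_ isT).
by rewrite -EE; move: TT; lra.
Qed.

(** * Descent along a line of weights *)

(** Since [phi' = 3 e + 6 r e' - 3 t'], the second alternative for [phi] says
    [r phi' <= (3 - k) phi + 6 (k - 1) r^2 n]. The target [q] satisfies the reverse inequality, so
    [r (phi - q)' <= (3 - k) (phi - q) <= 0] wherever [phi > q]. *)
Lemma cubic_descent (R : rcfType) (r0 n0 k e0 e1 e2 t0 t1 t2 t3 a b : R)
    (q : {poly R})
    (r := fun s : R => r0 + s) (n := fun s : R => n0 + k * s)
    (e := fun s : R => e0 + 2 * s * e1 + s ^+ 2 * e2) (e' := fun s : R => e1 + s * e2)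
    (t := fun s : R => t0 + 3 * s * t1 + 3 * s ^+ 2 * t2 + s ^+ 3 * t3)
    (t' := fun s : R => t1 + 2 * s * t2 + s ^+ 2 * t3)
    (phi := fun s : R => 3 * r s * e s - t s) :
    0 <= r0 -> 3 <= k -> 0 <= a <= b -> phi a <= q.[a] ->
    (forall s, a < s <= b ->
      (3 - k) * q.[s] + 6 * (k - 1) * r s ^+ 2 * n s <= r s * q^`().[s]) ->
    (forall s, a < s <= b -> phi s <= q.[s] \/
      k * phi s <= 3 * r s * t' s + 3 * (2 * r s * e s - t s)
        + 6 * r s ^+ 2 * ((k - 1) * n s - e' s)) ->
  phi b <= q.[b].
Proof.
move=> r00 k3 /andP[a0 ab] qa dq H.
pose p := 3 *: ((r0%:P + 'X) * (e0%:P + (2 * e1) *: 'X + e2 *: 'X^2)) -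
  (t0%:P + (3 * t1) *: 'X + (3 * t2) *: 'X^2 + t3 *: 'X^3) - q.
have pE s : p.[s] = phi s - q.[s].
  by rewrite /p !hornerE /phi /r /e /t /=; ring.
have dpE s : p^`().[s] = 3 * e s + 6 * r s * e' s - 3 * t' s - q^`().[s].
  by rewrite /p !derivE !hornerE /r /e /e' /t' /=; ring.
rewrite -subr_le0 -pE; apply: (@horner_le0_descent _ p a) => //.
  by rewrite pE subr_le0.
move=> s sab; rewrite pE subr_gt0 dpE => qs.
have [|{}H] := H s sab; first by rewrite leNgt qs.
have rs : 0 < r s by rewrite /r; move: sab => /andP[]; lra.
rewrite -(pmulr_rle0 _ rs); have := dq s sab.
have : 0 <= (k - 3) * (phi s - q.[s]) by rewrite mulr_ge0 // subr_ge0 // ltW.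
by rewrite /phi in H *; lra.
Qed.

(** * Weights on the parts *)

Section Parts.
Variables (R : rcfType) (V I : finType) (c : V -> I).
Implicit Types (F : rel V) (lam : I -> R).

Definition part_size i := #|[pred v | c v == i]|.

Definition part i v : R := (c v == i)%:R.

(** This passes to subgraphs on the same vertices, as the deletion of edges requires. *)
Definition no_cone F := forall u i,
  (part_size (c u) <= part_size i)%N -> exists2 v, c v = i & ~~ F u v.

Definition weight lam v := lam (c v).

Definition total lam := \sum_i lam i.

Lemma sum_part i : \sum_v part i v = (part_size i)%:R.
Proof.
rewrite /part_size -sum1_card natr_sum [RHS]big_mkcond.
by apply: eq_bigr => v _; rewrite inE /part; case: eqP.
Qed.

Lemma sum_weight lam (g : V -> R) :
  \sum_v weight lam v * g v = \sum_i lam i * \sum_v part i v * g v.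
Proof.
under [RHS]eq_bigr do rewrite mulr_sumr.
rewrite exchange_big; apply: eq_bigr => v _ /=.
rewrite (bigD1 (c v)) //= big1 ?addr0 => [|i ci]; last first.
  by rewrite /part eq_sym (negPf ci) mul0r mulr0.
by rewrite /part eqxx mul1r.
Qed.

Lemma sum_weightE lam :
  \sum_v weight lam v = \sum_i lam i * (part_size i)%:R.
Proof.
under eq_bigr do rewrite -[weight lam _]mulr1; rewrite sum_weight.
by apply: eq_bigr => i _; rewrite -sum_part; under eq_bigr do rewrite mulr1.
Qed.

Lemma deg_part_le F u i : no_cone F -> (part_size (c u) <= part_size i)%N ->
  deg F (part i) u <= (part_size i)%:R - 1.
Proof.
move=> nc /nc[v cv nFuv]; rewrite -sum_part /deg [X in _ <= X - 1](bigD1 v) //= (bigD1 v) //=.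
rewrite /adj (negPf nFuv) mulr0 add0r /part cv eqxx addrAC subrr add0r.
apply: ler_sum => w _; rewrite -natrM ler_nat.
by case: eqP; case: (F u w).
Qed.

(** The degree sum over a part of size 2 is at most [n], since each vertex of positive weight has at
    most one neighbour in it. The vertex of a part of size 1 misses a vertex of every part, so its
    degree is at most [n - r]. *)
Lemma Phi_small_parts F lam (r := total lam) (n := \sum_v weight lam v) :
    symmetric F -> no_cone F -> (forall i, (0 < part_size i)%N) ->
    (forall i, 0 <= lam i) -> (forall i, lam i != 0 -> (part_size i <= 2)%N) ->
  Phi F r (weight lam) <= 6 * r ^+ 2 * (n - r).
Proof.
move=> symF nc psize0 lam0 small.
have r0 : 0 <= r by apply: sumr_ge0.
have x0 u : 0 <= weight lam u by apply: lam0.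
have leE : edge_form F (weight lam) (weight lam) <= 2 * r * (n - r).
  rewrite edge_form_deg sum_weight.
  (* The summand merges both cases: the bound is [n] for size 2 and [n - r] for size 1. *)
  have -> : 2 * r * (n - r) =
      \sum_i lam i * (n - (2 - (part_size i)%:R) * r).
    have -> : \sum_i lam i * (n - (2 - (part_size i)%:R) * r) =
        \sum_i (lam i * (n - 2 * r) + lam i * (part_size i)%:R * r).
      by apply: eq_bigr => i _; ring.
    by rewrite big_split /= -!mulr_suml -sum_weightE -/n -/(total lam) -/r; ring.
  apply: ler_sum => i _; have [->|lami] := eqVneq (lam i) 0; first by rewrite !mul0r.
  apply: ler_wpM2l => //; have := small i lami; rewrite leq_eqVlt => /orP[/eqP s2|].
    rewrite s2 subrr mul0r subr0 -edge_form_deg edge_formC // edge_form_deg.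
    apply: ler_sum => v _; have [->|lamv] := eqVneq (weight lam v) 0; first by rewrite mul0r.
    rewrite ler_piMr //; apply: le_trans (deg_part_le nc _) _; rewrite s2 ?small //.
    by lra.
  rewrite ltnS leq_eqVlt ltnNge psize0 orbF => /eqP s1.
  rewrite s1 (_ : n - (2 - 1) * r = \sum_v part i v * (n - r)); last first.
    by rewrite -mulr_suml sum_part s1; ring.
  apply: ler_sum => v _; rewrite /part.
  case: (eqVneq (c v) i) => [cv|]; last by rewrite !mul0r.
  rewrite !mul1r /deg sum_weight /n sum_weightE /r /total -sumrB.
  apply: ler_sum => j _; rewrite -[X in _ - X]mulr1 -mulrBr ler_wpM2l //.
  by apply: deg_part_le; rewrite // cv s1 psize0.
have := tri_form_ge0 F x0 x0 x0.
have : 0 <= r * (2 * r * (n - r) - edge_form F (weight lam) (weight lam)).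
  by rewrite mulr_ge0 // subr_ge0.
by rewrite /Phi; lra.
Qed.

Lemma Phi_light_bound F lam C (r := total lam) (x := weight lam) (n := \sum_v x v)
    (k : R := (part_size C)%:R) (y := part C) :
    symmetric F -> no_cone F -> (forall i, 0 <= lam i) -> (0 < part_size C)%N ->
    (forall i, lam i != 0 -> (part_size i <= part_size C)%N) ->
    (forall u v, F u v -> codeg F x u v <= r) ->
  [\/ Phi F r x <= 6 * r ^+ 2 * (n - r),
      exists2 rho, r <= rho & Phi F r x <= 6 * r * (rho * (n - rho)) |
      k * Phi F r x <= 3 * r * tri_form F y x x +
        3 * (2 * r * edge_form F x x - tri_form F x x x) +
        6 * r ^+ 2 * ((k - 1) * n - edge_form F y x)].
Proof.
move=> symF nc lam0 C0 maxC light.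
have r0 : 0 <= r by apply: sumr_ge0.
have x0 u : 0 <= x u by apply: lam0.
have [v0 _] := card_gt0P C0.
have [v _ maxv] : exists2 v, true & forall u, Psi F r x u <= Psi F r x v.
  by case: (arg_maxP (Psi F r x) (isT : predT v0)) => v _ h; exists v => // u; apply: h.
have [le2|lt2] := lerP (2 * r ^+ 2) (Psi F r x v).
  have [|[]] := Phi_large_Psi symF r0 x0 light maxv le2; first by constructor 1.
  by constructor 2; exists (n - deg F x v).
constructor 3; apply: (Phi_clique_le symF r0 x0 light); [| | exact: sum_part |].
- by move=> u; apply: le_trans (maxv u) (ltW lt2).
- by move=> u; rewrite ler0n.
- by move=> u xu; rewrite deg_part_le // maxC // gt_eqF.
Qed.

End Parts.

(** * Choosing an edge to delete *)

Definition arcs (V : finType) (F : rel V) := [set p : V * V | F p.1 p.2].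

Lemma light_or_delete (R : realFieldType) (V : finType) (F : rel V) (x : V -> R) r :
    symmetric F -> irreflexive F -> (forall u, 0 <= x u) ->
  (forall u v, F u v -> codeg F x u v <= r) \/
  exists F' : rel V, [/\ symmetric F', subrel F' F, (#|arcs F'| < #|arcs F|)%N &
                         Phi F r x <= Phi F' r x].
Proof.
move=> symF irrF x0.
have [/existsP[a /existsP[b /andP[Fab heavy]]]|/existsPn light] :=
    boolP [exists a, exists b, F a b && (r < codeg F x a b)]; last first.
  left=> u v Fuv; have /existsPn/(_ v) := light u.
  by rewrite Fuv -leNgt.
right; pose E := [set (a, b); (b, a)].
pose F' u v := F u v && ((u, v) \notin E).
have EC u v : ((v, u) \in E) = ((u, v) \in E).
  by rewrite !inE !xpair_eqE orbC; congr (_ || _); apply: andbC.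
have symF' : symmetric F' by move=> u v; rewrite /F' symF EC.
have subF : subrel F' F by move=> u v /andP[].
have inE' u v : F u v -> ~~ F' u v -> (u, v) \in E.
  by rewrite /F' => ->; rewrite negbK.
exists F'; split=> //.
  apply: proper_card; apply/properP; split.
    by apply/subsetP => p; rewrite !inE => /subF.
  by exists (a, b); rewrite !inE ?Fab //= /F' !inE eqxx andbF.
apply: Phi_delete_le => // [u v w Fuv Fuw Fvw nF'uv|u v Fuv nF'uv].
  (* If two edges at [u] of one triangle were both [ab], then [v = w] or [a = b]. *)
  rewrite /F' Fuw /=; apply/negP => Euw; have Euv := inE' _ _ Fuv nF'uv.
  have ab : a != b by apply: contraTneq Fab => ->; rewrite irrF.
  have vw : v != w by apply: contraTneq Fvw => ->; rewrite irrF.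
  move: Euv Euw; rewrite !inE !xpair_eqE.
  move=> /orP[] /andP[/eqP uE /eqP vE] /orP[] /andP[/eqP uE' /eqP wE].
  - by rewrite vE wE eqxx in vw.
  - by rewrite -uE uE' eqxx in ab.
  - by rewrite -uE' uE eqxx in ab.
  - by rewrite vE wE eqxx in vw.
have := inE' _ _ Fuv nF'uv; rewrite !inE !xpair_eqE => /orP[]/andP[/eqP-> /eqP->].
  exact: ltW.
rewrite (_ : codeg F x b a = codeg F x a b) ?(ltW heavy) //.
by apply: eq_bigr => w _; rewrite (mulrC (adj _ _ b w)).
Qed.

(** * The weighted inequality *)

Section Induction.
Variables (R : rcfType) (V I : finType) (c : V -> I).
Implicit Types (F : rel V) (lam : I -> R).
Hypothesis part_gt0 : forall i, (0 < part_size c i)%N.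

Definition supp lam := [set i | lam i != 0].

Definition admissible F := [/\ symmetric F, irreflexive F & no_cone c F].

Lemma admissible_sub F F' :
  admissible F -> symmetric F' -> subrel F' F -> admissible F'.
Proof.
move=> [symF irrF nc] symF' subF; split=> //.
  by move=> u; apply: contraFF (irrF u); apply: subF.
by move=> u i /nc[v cv nF]; exists v => //; apply: contra nF; apply: subF.
Qed.

(** Lexicographic induction: when the support shrinks, the graph is arbitrary. When arcs are lost,
    the weights may still change within the support, because edges are deleted at intermediate
    points of a path of weights. *)
Lemma admissible_ind (Q : rel V -> (I -> R) -> Prop) :
  (forall F lam, admissible F -> (forall i, 0 <= lam i) ->
    (forall F' lam', admissible F' -> (forall i, 0 <= lam' i) ->
       supp lam' \proper supp lam -> Q F' lam') ->
    (forall F' lam', admissible F' -> (forall i, 0 <= lam' i) ->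
       supp lam' \subset supp lam -> (#|arcs F'| < #|arcs F|)%N -> Q F' lam') ->
    Q F lam) ->
  forall F lam, admissible F -> (forall i, 0 <= lam i) -> Q F lam.
Proof.
move=> step.
suff H m N F lam : admissible F -> (forall i, 0 <= lam i) ->
    (#|supp lam| < m)%N -> (#|arcs F| < N)%N -> Q F lam.
  by move=> F lam aF lam0; apply: (H #|supp lam|.+1 #|arcs F|.+1).
elim: m N F lam => // m IHm; elim=> // N IHN F lam aF lam0 sm sN.
apply: step => // F' lam' aF' lam'0.
  by move=> /proper_card ss; apply: (IHm #|arcs F'|.+1) => //; apply: leq_trans ss _.
move=> /subset_leq_card ss aFF'; apply: IHN => //; first exact: leq_ltn_trans ss sm.
exact: leq_trans aFF' _.
Qed.

Definition set_part lam C (s : R) i := if i == C then s else lam i.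

Lemma set_part_id lam C : set_part lam C (lam C) =1 lam.
Proof. by move=> i; rewrite /set_part; case: eqP => [->|]. Qed.

Lemma set_part_ge0 lam C s :
  (forall i, 0 <= lam i) -> 0 <= s -> forall i, 0 <= set_part lam C s i.
Proof. by move=> l0 s0 i; rewrite /set_part; case: eqP. Qed.

Lemma supp_set_part lam C s : lam C != 0 -> supp (set_part lam C s) \subset supp lam.
Proof.
move=> lC; apply/subsetP => i; rewrite !inE /set_part.
by case: (i =P C) => [->|].
Qed.

Lemma supp_set_part0 lam C : lam C != 0 -> supp (set_part lam C 0) \proper supp lam.
Proof.
move=> lC; rewrite properE supp_set_part //=; apply/subsetPn; exists C.
  by rewrite inE.
by rewrite inE /set_part eqxx negbK.
Qed.

Lemma weight_set_part lam C s v :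
  weight c (set_part lam C s) v = weight c (set_part lam C 0) v + s * part R c C v.
Proof.
rewrite /weight /set_part /part; case: eqP => _; rewrite ?mulr0 ?addr0 //.
by rewrite add0r mulr1.
Qed.

Lemma total_set_part lam C s :
  total (set_part lam C s) = total (set_part lam C 0) + s.
Proof.
rewrite /total (bigD1 C) // [X in _ = X + s](bigD1 C) //=.
rewrite /set_part eqxx add0r addrC; congr (_ + _).
by apply: eq_bigr => i /negPf ->.
Qed.

Lemma sum_weight_set_part lam C s :
  \sum_v weight c (set_part lam C s) v =
  \sum_v weight c (set_part lam C 0) v + (part_size c C)%:R * s.
Proof.
under eq_bigr do rewrite weight_set_part.
by rewrite big_split /= -mulr_sumr sum_part mulrC.
Qed.

(** The descent shared by both bounds: the weight of a largest part [C] grows from [a] to [lam C].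
    At each point either an edge is deleted and induction applies, or [Phi_light_bound] supplies
    what [cubic_descent] asks for. *)
Lemma Phi_path F lam C a (q : {poly R}) (l := set_part lam C)
    (r := fun s => total (l s)) (n := fun s => \sum_v weight c (l s) v)
    (k : R := (part_size c C)%:R) :
    admissible F -> (forall i, 0 <= lam i) -> (2 < part_size c C)%N ->
    (forall i, lam i != 0 -> (part_size c i <= part_size c C)%N) -> lam C != 0 ->
    0 <= a <= lam C -> Phi F (r a) (weight c (l a)) <= q.[a] ->
    (forall s, a < s <= lam C ->
      (3 - k) * q.[s] + 6 * (k - 1) * r s ^+ 2 * n s <= r s * q^`().[s]) ->
    (forall s rho, a < s <= lam C -> r s <= rho ->
      6 * r s * (rho * (n s - rho)) <= q.[s]) ->
    (forall s F', a < s <= lam C -> admissible F' -> (#|arcs F'| < #|arcs F|)%N ->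
      Phi F' (r s) (weight c (l s)) <= q.[s]) ->
  Phi F (total lam) (weight c lam) <= q.[lam C].
Proof.
move=> aF lam0 kC maxC lC aC qa dq qrho IH.
have [symF irrF nc] := aF.
pose x0 := weight c (l 0); pose y := part R c C.
have xE s : weight c (l s) =1 (fun v => x0 v + s * y v) by move=> v; apply: weight_set_part.
pose e0 := edge_form F x0 x0; pose e1 := edge_form F y x0; pose e2 := edge_form F y y.
pose t0 := tri_form F x0 x0 x0; pose t1 := tri_form F y x0 x0.
pose t2 := tri_form F y y x0; pose t3 := tri_form F y y y.
have rE s : r s = r 0 + s by apply: total_set_part.
have nE s : n s = n 0 + k * s by apply: sum_weight_set_part.
have eE s : edge_form F (weight c (l s)) (weight c (l s)) = e0 + 2 * s * e1 + s ^+ 2 * e2.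
  by rewrite !(eq_edge_form F (xE s) (xE s)) edge_form_line.
have e'E s : edge_form F y (weight c (l s)) = e1 + s * e2.
  by rewrite (eq_edge_form F (frefl y) (xE s)) edge_form_line1.
have tE s : tri_form F (weight c (l s)) (weight c (l s)) (weight c (l s)) =
    t0 + 3 * s * t1 + 3 * s ^+ 2 * t2 + s ^+ 3 * t3.
  by rewrite (eq_tri_form F (xE s) (xE s) (xE s)) tri_form_line.
have t'E s : tri_form F y (weight c (l s)) (weight c (l s)) =
    t1 + 2 * s * t2 + s ^+ 2 * t3.
  by rewrite (eq_tri_form F (frefl y) (xE s) (xE s)) tri_form_line1.
have PhiE s : Phi F (r s) (weight c (l s)) = 3 * (r 0 + s) *
    (e0 + 2 * s * e1 + s ^+ 2 * e2) - (t0 + 3 * s * t1 + 3 * s ^+ 2 * t2 + s ^+ 3 * t3).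
  by rewrite /Phi eE tE rE.
have -> : Phi F (total lam) (weight c lam) = Phi F (r (lam C)) (weight c (l (lam C))).
  have wE : weight c (l (lam C)) =1 weight c lam by move=> v; apply: set_part_id.
  rewrite /Phi (eq_edge_form F wE wE) (eq_tri_form F wE wE wE); congr (_ * _ * _ - _).
  by apply: eq_bigr => i _; rewrite /l set_part_id.
rewrite PhiE; apply: (@cubic_descent _ (r 0) (n 0) k e0 e1 e2 t0 t1 t2 t3 a).
- by apply: sumr_ge0 => i _; apply: set_part_ge0.
- by rewrite ler_nat.
- by [].
- by rewrite -PhiE.
- by move=> s sa; rewrite -rE -nE; apply: dq.
move=> s sa; rewrite -PhiE -rE -nE -eE -e'E -tE -t'E -/(Phi _ _ _).
have s0 : 0 <= s by case/andP: sa => ? _; case/andP: aC => ? _; lra.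
have l0 := set_part_ge0 C lam0 s0.
have maxCs i : l s i != 0 -> (part_size c i <= part_size c C)%N.
  move=> lsi; apply: maxC; have /subsetP/(_ i) := supp_set_part s lC.
  by rewrite !inE => /(_ lsi).
have [light|[F' [symF' subF ltF le]]] :=
    light_or_delete (r s) symF irrF (fun v => l0 (c v)).
- have [le|[rho le_rho le]|] := Phi_light_bound symF nc l0 (part_gt0 C) maxCs light.
  (* The first alternative is the second one with [rho = r]. *)
  + left; apply: le_trans le _; apply: le_trans (qrho _ _ sa (lexx (r s))).
    by rewrite /r /n; lra.
  + by left; apply: le_trans le _; apply: qrho.
  + by right.
- by left; apply: le_trans le _; apply: IH => //; apply: admissible_sub subF.
Qed.

Lemma max_part lam : supp lam != set0 ->
  exists2 C, lam C != 0 & forall i, lam i != 0 -> (part_size c i <= part_size c C)%N.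
Proof.
move=> /set0Pn[i0]; rewrite inE => li0.
case: (@arg_maxnP _ i0 (fun i => lam i != 0) (part_size c) li0) => C lC maxC.
by exists C.
Qed.

(** This bound satisfies the differential condition of [Phi_path] with equality. The assumption
    [n <= 2 r] serves the condition on [rho]: [rho (n - rho)] decreases for [rho >= n / 2], hence is
    largest at [rho = r]. *)
Lemma Phi_few_vertices F lam (r := total lam) (n := \sum_v weight c lam v) :
  admissible F -> (forall i, 0 <= lam i) -> n <= 2 * r ->
  Phi F r (weight c lam) <= 6 * r ^+ 2 * (n - r).
Proof.
rewrite /r /n => {r n} aF lam0; move: F lam aF lam0.
apply: admissible_ind => F lam aF lam0 IHs IHF n2r.
have [symF irrF nc] := aF.
have [small|big] := boolP [forall i, (lam i != 0) ==> (part_size c i <= 2)%N].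
  apply: Phi_small_parts => // i li.
  by have := forallP small i; rewrite li.
have [C lC maxC] : exists2 C, lam C != 0 &
    forall i, lam i != 0 -> (part_size c i <= part_size c C)%N.
  apply: max_part; apply/set0Pn.
  by have /forallPn[i] := big; rewrite negb_imply => /andP[li _]; exists i; rewrite inE.
have C3 : (2 < part_size c C)%N.
  have /forallPn[i] := big; rewrite negb_imply -ltnNge => /andP[li i3].
  exact: leq_trans i3 (maxC i li).
pose k : R := (part_size c C)%:R; have k3 : 3 <= k by rewrite ler_nat.
pose r0 := total (set_part lam C 0); pose n0 := \sum_v weight c (set_part lam C 0) v.
pose q : {poly R} := 6 *: ((r0%:P + 'X) ^+ 2 * (n0%:P + k *: 'X - (r0%:P + 'X))).
have qE s : q.[s] = 6 * (r0 + s) ^+ 2 * (n0 + k * s - (r0 + s)).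
  by rewrite /q !hornerE /=; ring.
have dqE s : q^`().[s] = 12 * (r0 + s) * (n0 + k * s - (r0 + s)) +
    6 * (r0 + s) ^+ 2 * (k - 1).
  by rewrite /q !derivE !hornerE /=; ring.
have lamCid : set_part lam C (lam C) =1 lam := set_part_id lam C.
have totE : total lam = r0 + lam C.
  by rewrite -total_set_part; apply: eq_bigr => i _; rewrite lamCid.
have nE : \sum_v weight c lam v = n0 + k * lam C.
  by rewrite -sum_weight_set_part; apply: eq_bigr => v _; rewrite /weight lamCid.
have lCge0 := lam0 C.
(* [n - 2 r] has slope [k - 2 > 0] in [s], so its sign at [lam C] persists for smaller [s]. *)
have n2rs s : s <= lam C -> n0 + k * s <= 2 * (r0 + s).
  move=> sC; have : 0 <= (k - 2) * (lam C - s) by rewrite mulr_ge0; lra.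
  by move: n2r; rewrite nE totE; lra.
have r00 : 0 <= r0 by apply: sumr_ge0 => i _; apply: set_part_ge0.
rewrite [leRHS](_ : _ = q.[lam C]); last by rewrite qE nE totE.
apply: (@Phi_path F lam C 0) => //.
- by rewrite lexx.
- rewrite qE addr0 mulr0 addr0; apply: IHs => //; first exact: set_part_ge0.
    exact: supp_set_part0.
  by rewrite -/n0 -/r0; have := n2rs 0 lCge0; lra.
- move=> s _; rewrite total_set_part sum_weight_set_part -/r0 -/n0 -/k qE dqE.
  by rewrite le_eqVlt; apply/orP; left; apply/eqP; ring.
- move=> s rho /andP[s0 sC]; rewrite total_set_part sum_weight_set_part -/r0 -/n0 -/k qE.
  have := n2rs s sC; have : 0 <= r0 + s by lra.
  move: (r0 + s) (n0 + k * s) => r n rge0 nr rrho.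
  (* [(rho - r) (rho + r - n)] is [r (n - r) - rho (n - rho)]. *)
  have : 0 <= r * ((rho - r) * (rho + r - n)) by rewrite !mulr_ge0; lra.
  by lra.
move=> s F' /andP[s0 sC] aF' ltF.
rewrite qE -total_set_part -sum_weight_set_part; apply: IHF => //.
- by apply: set_part_ge0; rewrite ?ltW.
- exact: supp_set_part.
by rewrite total_set_part sum_weight_set_part; apply: n2rs.
Qed.

Lemma Phi_le F lam (r := total lam) (n := \sum_v weight c lam v) :
  admissible F -> (forall i, 0 <= lam i) ->
  Phi F r (weight c lam) <= 3 / 2 * (r * n ^+ 2).
Proof.
have few F' lam' (r' := total lam') (n' := \sum_v weight c lam' v) :
    admissible F' -> (forall i, 0 <= lam' i) -> n' <= 2 * r' ->
    Phi F' r' (weight c lam') <= 3 / 2 * (r' * n' ^+ 2).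
  move=> aF' l0 /(Phi_few_vertices aF' l0) le; apply: le_trans le _.
  (* The two bounds differ by [3/2] times this square term, so they agree at [n = 2 r]. *)
  have : 0 <= r' * (n' - 2 * r') ^+ 2 by rewrite mulr_ge0 ?sqr_ge0 ?sumr_ge0.
  by rewrite -/r' -/n'; lra.
rewrite /r /n => {r n} aF lam0; move: F lam aF lam0.
apply: admissible_ind => F lam aF lam0 IHs IHF.
have [|n2r] := lerP (\sum_v weight c lam v) (2 * total lam); first exact: few.
have [symF irrF nc] := aF.
have [i li i3] : exists2 i, lam i != 0 & (2 < part_size c i)%N.
  have [/existsP[i /andP[]]|/existsPn small] :=
    boolP [exists i, (lam i != 0) && (2 < part_size c i)%N]; first by exists i.
  move: n2r; rewrite ltNge sum_weightE /total mulr_sumr => /negP[].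
  apply: ler_sum => i _; have := small i; rewrite negb_and negbK -leqNgt.
  case/orP=> [/eqP->|]; first by rewrite mul0r mulr0.
  by rewrite mulrC -(ler_nat R) => le2; rewrite ler_wpM2r.
have [C lC maxC] : exists2 C, lam C != 0 &
    forall i, lam i != 0 -> (part_size c i <= part_size c C)%N.
  by apply: max_part; apply/set0Pn; exists i; rewrite inE.
have C3 : (2 < part_size c C)%N by apply: leq_trans i3 (maxC i li).
pose k : R := (part_size c C)%:R; have k3 : 3 <= k by rewrite ler_nat.
pose r0 := total (set_part lam C 0); pose n0 := \sum_v weight c (set_part lam C 0) v.
pose q : {poly R} := (3 / 2) *: ((r0%:P + 'X) * (n0%:P + k *: 'X) ^+ 2).
have qE s : q.[s] = 3 / 2 * ((r0 + s) * (n0 + k * s) ^+ 2).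
  by rewrite /q !hornerE /=; ring.
have dqE s : q^`().[s] = 3 / 2 * ((n0 + k * s) ^+ 2 +
    2 * k * (r0 + s) * (n0 + k * s)).
  by rewrite /q !derivE !hornerE /=; ring.
have lamCid : set_part lam C (lam C) =1 lam := set_part_id lam C.
have totE : total lam = r0 + lam C.
  by rewrite -total_set_part; apply: eq_bigr => j _; rewrite lamCid.
have nE : \sum_v weight c lam v = n0 + k * lam C.
  by rewrite -sum_weight_set_part; apply: eq_bigr => v _; rewrite /weight lamCid.
have lCge0 := lam0 C.
have r00 : 0 <= r0 by apply: sumr_ge0 => j _; apply: set_part_ge0.
have n00 : 0 <= n0 by apply: sumr_ge0 => v _; apply: set_part_ge0.
(* The path starts where [n = 2 r], or at weight [0] if [n >= 2 r] already there:
   the descent condition for this bound needs [n >= 2 r]. *)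
have [a aC [nra qa]] : exists2 a, 0 <= a <= lam C & 2 * (r0 + a) <= n0 + k * a /\
    Phi F (total (set_part lam C a)) (weight c (set_part lam C a)) <= q.[a].
  have [n2r0|n2r0] := lerP (2 * r0) n0.
    exists 0; first by rewrite lexx.
    split; first by lra.
    rewrite qE addr0 mulr0 addr0; apply: IHs => //; first exact: set_part_ge0.
    exact: supp_set_part0.
  pose a := (2 * r0 - n0) / (k - 2).
  have ka : (k - 2) * a = 2 * r0 - n0 by rewrite /a mulrC divfK //; lra.
  have a0 : 0 <= a by rewrite divr_ge0; lra.
  exists a; first rewrite a0 -(@ler_pM2l _ (k - 2)) ?ka; first by lra.
    by move: n2r; rewrite nE totE; lra.
  split; first by lra.
  rewrite qE -total_set_part -sum_weight_set_part; apply: few => //.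
    exact: set_part_ge0.
  by rewrite total_set_part sum_weight_set_part -/r0 -/n0 -/k; lra.
have n2rs s : a < s -> 2 * (r0 + s) <= n0 + k * s.
  move=> sa; have : 0 <= (k - 2) * (s - a) by rewrite mulr_ge0; lra.
  by lra.
rewrite [leRHS](_ : _ = q.[lam C]); last by rewrite qE nE totE.
apply: (@Phi_path F lam C a) => //.
- move=> s /andP[sa sC]; rewrite total_set_part sum_weight_set_part -/r0 -/n0 -/k qE dqE.
  have := n2rs s sa; have : 0 <= r0 + s by case/andP: aC; lra.
  move: (r0 + s) (n0 + k * s) => r n rge0 nr.
  (* The two sides of the differential condition differ by [3/2] times this product. *)
  have : 0 <= (k - 2) * (r * (n * (n - 2 * r))) by rewrite !mulr_ge0; lra.
  by lra.
- move=> s rho /andP[sa _] _; rewrite total_set_part sum_weight_set_part -/r0 -/n0 -/k qE.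
  have : 0 <= (r0 + s) * (n0 + k * s - 2 * rho) ^+ 2.
    by rewrite mulr_ge0 ?sqr_ge0 //; case/andP: aC; lra.
  by lra.
move=> s F' /andP[sa sC] aF' ltF.
rewrite qE -total_set_part -sum_weight_set_part; apply: IHF => //.
- by apply: set_part_ge0; rewrite // ltW //; case/andP: aC; lra.
- exact: supp_set_part.
Qed.

End Induction.

(** * Greedy partitions *)

Section CliqueTuples.
Variables (T : finType) (e : rel T).
Hypotheses (e_sym : symmetric e) (e_irr : irreflexive e).

Lemma is_cliqueP (A : {set T}) :
  reflect {in A &, forall x y, x != y -> e x y} (is_clique e A).
Proof.
apply: (iffP forall_inP) => [h x y xA yA|h x xA].
  by have /forall_inP/(_ y yA)/implyP := h x xA.
by apply/forall_inP => y yA; apply/implyP; apply: h.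
Qed.

(** Each clique of size [k] is the underlying set of [k!] duplicate-free tuples; this yields the
    factors 2 and 6 in the unit-weight forms below. *)
Lemma card_clique_tuples k :
  #|[set t : k.-tuple T | uniq t & is_clique e [set x in t]]| =
  (#|[set A : {set T} | (#|A| == k) && is_clique e A]| * k`!)%N.
Proof.
rewrite -sum1_card (partition_big (fun t : k.-tuple T => [set x in t])
  (mem [set A : {set T} | (#|A| == k) && is_clique e A])) /=; last first.
  move=> t; rewrite !inE => /andP[ut ->]; rewrite andbT cardsE.
  by rewrite (card_uniqP ut) size_tuple.
rewrite -sum_nat_const; apply: eq_bigr => A; rewrite inE => /andP[/eqP sA clA].
have -> : k`! = (#|A| ^_ k)%N by rewrite sA ffactnn.
rewrite sum1_card -card_uniq_tuples; apply: eq_card => t; rewrite unfold_in /= !inE.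
apply/idP/idP.
  move=> /andP[/andP[ut _] /eqP tA]; rewrite ut andbT; apply/allP => x xt.
  by suff : x \in A by []; rewrite -tA inE.
move=> /andP[/allP tA ut].
have -> : [set x in t] = A.
  apply/eqP; rewrite eqEcard cardsE (card_uniqP ut) size_tuple sA leqnn andbT.
  by apply/subsetP => x; rewrite inE; apply: tA.
by rewrite ut clA eqxx.
Qed.

Lemma edge_form1 (R : realFieldType) :
  edge_form e (fun=> 1 : R) (fun=> 1) = 2 * (n_edges e)%:R.
Proof.
have := card_clique_tuples 2; rewrite -/(n_edges e) => /(congr1 (fun m => m%:R : R)).
rewrite natrM mulrC => <-; rewrite /edge_form pair_bigA -sum1_card natr_sum [RHS]big_mkcond /=.
rewrite [RHS](reindex (fun p : T * T => [tuple p.1; p.2])) /=; last first.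
  exists (fun t => (tnth t ord0, tnth t ord_max)) => [[u v] _ //|t _].
  by case/tupleP: t => u t; case/tupleP: t => v t; rewrite [t]tuple0; apply: val_inj.
apply: eq_bigr => -[u v] _ /=; rewrite !mul1r /adj inE /= inE andbT.
case: ifP => [/andP[uv /is_cliqueP cl]|].
  by rewrite cl // !inE eqxx ?orbT.
case euv: (e u v) => // /negP[]; apply/andP; split.
  by apply: contraTneq euv => ->; rewrite e_irr.
apply/is_cliqueP => x y; rewrite !inE.
by move=> /orP[]/eqP-> /orP[]/eqP->; rewrite ?eqxx // e_sym.
Qed.

Lemma tri_form1 (R : realFieldType) :
  tri_form e (fun=> 1 : R) (fun=> 1) (fun=> 1) = 6 * (n_triangles e)%:R.
Proof.
have := card_clique_tuples 3; rewrite -/(n_triangles e) => /(congr1 (fun m => m%:R : R)).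
rewrite natrM mulrC => <-; rewrite /tri_form.
under eq_bigr do rewrite pair_bigA.
rewrite pair_bigA /= -sum1_card natr_sum [RHS]big_mkcond /=.
rewrite [RHS](reindex (fun p : T * (T * T) => [tuple p.1; p.2.1; p.2.2])) /=; last first.
  exists (fun t => (tnth t ord0, (tnth t (inord 1), tnth t ord_max))) => [[u [v w]] _ /=|t _].
    by rewrite !(tnth_nth u) /= inordK.
  case/tupleP: t => u t; case/tupleP: t => v t; case/tupleP: t => w t; rewrite [t]tuple0.
  by apply: val_inj; rewrite /= !(tnth_nth u) /= inordK.
apply: eq_bigr => -[u [v w]] _ /=; rewrite !mul1r /adj inE /= !inE !andbT negb_or.
case: ifP => [/andP[/andP[/andP[uv uw] vw] /is_cliqueP cl]|].
  by rewrite !cl ?mul1r // !inE eqxx ?orbT.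
case euv: (e u v); rewrite ?mul0r //; case euw: (e u w); rewrite ?mulr0 ?mul0r //.
case evw: (e v w); rewrite ?mulr0 // => /negP[].
have ne x y : e x y -> x != y by apply: contraTneq => ->; rewrite e_irr.
rewrite !ne //=; apply/is_cliqueP => x y; rewrite !inE.
by move=> /or3P[]/eqP-> /or3P[]/eqP->; rewrite ?eqxx // e_sym.
Qed.

End CliqueTuples.

Section GreedyParts.
Variables (T : finType) (e : rel T) (P : seq {set T}).
Hypotheses (e_sym : symmetric e) (e_irr : irreflexive e).
Hypothesis hP : greedy_partition e P.

Lemma part_index_lt x : (find (fun C : {set T} => x \in C) P < size P)%N.
Proof. by case: hP => -[_ _ cov _] _; rewrite -has_find has_count cov. Qed.

Definition part_index x := Ordinal (part_index_lt x).

Lemma part_indexE x (i : 'I_(size P)) : (x \in nth set0 P i) = (part_index x == i).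
Proof.
have xc : x \in nth set0 P (part_index x).
  by apply: (@nth_find _ set0 (fun C : {set T} => x \in C)); rewrite has_find part_index_lt.
apply/idP/eqP => [xi|<- //].
have /eq_leq/card_le1_eqP one : #|[pred j : 'I_(size P) | x \in nth set0 P j]| = 1%N.
  case: hP => -[_ _ cov _] _; rewrite -(cov x) -sum1_count (big_nth set0) big_mkord.
  by rewrite sum1_card.
by apply: one; rewrite inE.
Qed.

Lemma part_size_index (i : 'I_(size P)) : part_size part_index i = #|nth set0 P i|.
Proof. by apply: eq_card => x; rewrite inE part_indexE. Qed.

(** A vertex outside part [i] joined to all of it would extend that part to a clique one larger,
    inside the union of the parts up to the later index [j]. A vertex of part [i] is its own
    non-neighbour. *)
Lemma no_cone_greedy : no_cone part_index e.
Proof.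
move=> u i; rewrite !part_size_index => le_ui.
have [iu|ui] := eqVneq (part_index u) i; first by exists u; rewrite // e_irr.
have [[_ cliques _ srt] greedy] := hP.
have [/exists_inP[v]|/exists_inPn cone] :=
    boolP [exists v in nth set0 P i, ~~ e u v].
  by rewrite part_indexE => /eqP pv nev; exists v.
pose j := maxn (part_index u) i.
have jP : (j < size P)%N by rewrite gtn_max !ltn_ord.
have leP (a b : 'I_(size P)) : (a <= b)%N -> (#|nth set0 P a| <= #|nth set0 P b|)%N.
  move=> ab; apply: (sorted_leq_nth _ _ set0 srt) => //; rewrite ?inE ?ltn_ord //.
  by move=> A B C; apply: leq_trans.
(* If [u] lies in the later part, sortedness and [le_ui] make both sizes equal, so greediness at [j]
   forbids exactly the size of the enlarged clique. *)
have sj : #|nth set0 P j| = #|nth set0 P i|.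
  rewrite /j /maxn; case: ltnP => // iu; apply/eqP; rewrite eqn_leq le_ui andTb.
  exact: (leP i (part_index u)).
have uNi : u \notin nth set0 P i by rewrite part_indexE.
have sub (m : 'I_(size P)) : (m <= j)%N ->
    nth set0 P m \subset \bigcup_(C <- take j.+1 P) C.
  move=> mj; rewrite bigcup_seq; apply: (bigcup_sup (nth set0 P m)).
  rewrite -(nth_take set0 (n0 := j.+1)) ?ltnS // mem_nth // size_takel //.
have clK : is_clique e (u |: nth set0 P i).
  have /is_cliqueP clC : is_clique e (nth set0 P i) by apply: (allP cliques); apply: mem_nth.
  have uC v : v \in nth set0 P i -> e u v by move=> /cone; rewrite negbK.
  apply/is_cliqueP => x y; rewrite !inE => /orP[/eqP->|xC] /orP[/eqP->|yC] xy.
  - by rewrite eqxx in xy.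
  - exact: uC.
  - by rewrite e_sym uC.
  - exact: clC.
have := greedy j jP (u |: nth set0 P i).
rewrite subUset sub1set (subsetP (sub (part_index u) _)) ?leq_maxl ?part_indexE ?eqxx //.
rewrite sub ?leq_maxr // cardsU1 uNi sj => /(_ isT clK).
by rewrite eqxx.
Qed.

Lemma part_size_gt0 (i : 'I_(size P)) : (0 < part_size part_index i)%N.
Proof.
case: hP => -[ne _ _ _] _; rewrite part_size_index card_gt0.
by apply: (allP ne); apply: mem_nth.
Qed.

End GreedyParts.

Theorem theorem2 (T : finType) (e : rel T)
  (e_sym : symmetric e) (e_irr : irreflexive e)
  (P : seq {set T}) (hP : greedy_partition e P) :
  (size P)%:R * ((n_edges e)%:R - (#|T|%:R) ^+ 2 / 4) <= (n_triangles e)%:R :> rat.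
Proof.
have adm : admissible (part_index hP) e by split=> //; apply: no_cone_greedy.
(* Unit weights turn [r] and [n] into [size P] and [#|T|]. The descent needs a real closed field, so
   the bound is taken over [realalg] and pulled back to [rat]. *)
have := Phi_le (R := realalg) (part_size_gt0 hP) adm (fun i => ler01).
have sum1 (I : finType) : \sum_(i : I) 1 = #|I|%:R :> realalg.
  by rewrite -sum1_card natr_sum.
rewrite /total /weight !sum1 card_ord /Phi edge_form1 // tri_form1 // => le.
rewrite -(ler_rat realalg) !(rmorphM, rmorphB, rmorphXn, fmorphV, rmorph_nat) /=.
by lra.
Qed.
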